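(* Let $A$ be a ring and let $M$ and $N$ be $A$-modules. Then $\mathrm{Ext}^1_A(M,N)$ can be identified with the set of isomorphism classes of $N$-torsors. Precisely, under the standard identification of $\mathrm{Ext}^1_A(M,N)$ with the set of isomorphism classes of extensions of $M$ by $N$, the map sending the class of an extension $(f:P\to M,\ \alpha_f)$ to the isomorphism class of the $N$-torsor $(f,\tau_f)$, where $\tau_f(n,p)=\alpha_f(n)+p$ for $(n,p)\in N\oplus P$, is a bijection from $\mathrm{Ext}^1_A(M,N)$ onto the set of isomorphism classes of objects of the category of $N$-torsors.
   Context: $A$ is a ring with multiplicative identity, not necessarily commutative; ''$A$-module'' means left $A$-module. $M$ and $N$ are fixed $A$-modules. The category of $A$-modules over $M$ has as objects the $A$-module homomorphisms $f:P\to M$, and as morphisms from $f:P\to M$ to $g:Q\to M$ the $A$-module homomorphisms $h:P\to Q$ with $g\circ h=f$. An extension (of $M$ by $N$) is a surjective $A$-module homomorphism $f:P\to M$ together with an isomorphism of $A$-modules $\alpha_f:N\to\ker(f)$. A morphism of extensions from $f:P\to M$ to $g:Q\to M$ is a morphism $h:f\to g$ of $A$-modules over $M$ such that $h(\alpha_f(n))=\alpha_g(n)$ for all $n\in N$. Recall that $\mathrm{Ext}^1_A(M,N)$ is identified in the standard way with the set of isomorphism classes of extensions. For an object $f:P\to M$ over $M$, $\beta_f:N\oplus P\to M$ denotes the object over $M$ given by $\beta_f(n,p)=f(p)$, and for objects $f:P\to M$, $g:Q\to M$ one puts $P\times_M Q=\{(p,q)\in P\oplus Q : f(p)=g(q)\}$.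 An $N$-torsor is a surjective $A$-module homomorphism $f:P\to M$ together with a morphism $\tau_f:\beta_f\to f$ of $A$-modules over $M$ (that is, an $A$-module homomorphism $\tau_f:N\oplus P\to P$ with $f\circ\tau_f=\beta_f$) such that (1) $\tau_f(0,p)=p$ for each $p\in P$; (2) for each $(p_1,p_2)\in P\times_M P$ there exists a unique $n\in N$ with $\tau_f(n,p_2)=p_1$. A morphism of $N$-torsors from $f:P\to M$ to $g:Q\to M$ is a morphism $h:f\to g$ of $A$-modules over $M$ such that $h(\tau_f(n,p))=\tau_g(n,h(p))$ for all $(n,p)\in N\oplus P$. *)

(* Defs.v *)
From HB Require Import structures.
From mathcomp Require Import all_boot all_algebra.

Set Implicit Arguments.
Unset Strict Implicit.
Unset Printing Implicit Defensive.

Import GRing.Theory.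
Local Open Scope ring_scope.

(* The ring A is a [pzRingType]: associative, unital, not necessarily
   commutative, and possibly zero. *)

Section Kernel.
Variables (A : pzRingType) (P M : lmodType A) (f : {linear P -> M}).

Definition in_ker : {pred P} := fun p => f p == 0.

Fact in_ker_submod_closed : submod_closed in_ker.
Proof.
split=> [|a p q /eqP fp0 /eqP fq0]; first by rewrite unfold_in linear0.
by rewrite unfold_in linearP fp0 fq0 scaler0 addr0.
Qed.

HB.instance Definition _ :=
  GRing.isSubmodClosed.Build A P in_ker in_ker_submod_closed.

Record ker := Ker { ker_val :> P; _ : ker_val \in in_ker }.

HB.instance Definition _ := [isSub for ker_val].
HB.instance Definition _ := [Choice of ker by <:].
HB.instance Definition _ := [SubChoice_isSubLmodule of ker by <:].
End Kernel.

Section OverM.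
Variables (A : pzRingType) (M : lmodType A).

Record over := Over {
  over_mod :> lmodType A;
  over_map : {linear over_mod -> M} }.

Record over_hom (f g : over) := OverHom {
  hom_map :> {linear f -> g};
  hom_over : forall p : f, over_map g (hom_map p) = over_map f p }.

Definition fiber_product (f g : over) : {pred (f * g)%type} :=
  fun x => over_map f x.1 == over_map g x.2.

Definition surjective_over (f : over) : Prop :=
  forall m : M, exists p : f, over_map f p = m.
End OverM.

Arguments fiber_product {A M} f g.

Section Extensions.
Variables (A : pzRingType) (M N : lmodType A).

Record extension_on (f : over M) := ExtensionOn {
  ext_surj : surjective_over f;
  ext_alpha : {linear N -> ker (over_map f)};
  ext_alpha_bij : bijective ext_alpha }.

Record extension := Extension {
  ext_over :> over M;
  ext_struct : extension_on ext_over }.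

Definition alpha (E : extension) : {linear N -> ker (over_map E)} :=
  ext_alpha (ext_struct E).

Definition is_ext_hom (E F : extension) (h : over_hom E F) : Prop :=
  forall n : N, h (val (alpha E n)) = val (alpha F n).

Definition ext_iso (E F : extension) : Prop :=
  exists (h : over_hom E F) (k : over_hom F E),
    [/\ is_ext_hom h, is_ext_hom k, cancel h k & cancel k h].
End Extensions.

Section Torsors.
Variables (A : pzRingType) (M N : lmodType A).

Definition beta (f : over M) : over M :=
  Over (over_map f \o snd : {linear (N * f)%type -> M}).

Record torsor_on (f : over M) := TorsorOn {
  tors_surj : surjective_over f;
  tors_tau : over_hom (beta f) f;
  tors_tau0 : forall p : f, tors_tau (0, p) = p;
  tors_tau_trans : forall x : (f * f)%type, x \in fiber_product f f ->
    exists! n : N, tors_tau (n, x.2) = x.1 }.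

Record torsor := Torsor {
  tors_over :> over M;
  tors_struct : torsor_on tors_over }.

Definition tau (T : torsor) : over_hom (beta T) T := tors_tau (tors_struct T).

Definition is_tors_hom (S T : torsor) (h : over_hom S T) : Prop :=
  forall (n : N) (p : S), h (tau S (n, p)) = tau T (n, h p).

Definition tors_iso (S T : torsor) : Prop :=
  exists (h : over_hom S T) (k : over_hom T S),
    [/\ is_tors_hom h, is_tors_hom k, cancel h k & cancel k h].
End Torsors.

(* The quotient of T by an equivalence relation r, as the type of its
   classes. *)
Section Classes.
Variables (T : Type) (r : T -> T -> Prop).

Definition classes : Type := {C : T -> Prop | exists x : T, C = r x}.

Definition class_of (x : T) : classes :=
  exist (fun C => exists y, C = r y) (r x) (ex_intro _ x erefl).
End Classes.

(* Ext^1 is taken in Yoneda's form, i.e. through its standard identification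
   with the isomorphism classes of extensions. *)
Definition Ext1 (A : pzRingType) (M N : lmodType A) : Type :=
  classes (@ext_iso A M N).

Definition ext_class (A : pzRingType) (M N : lmodType A)
  (E : extension M N) : Ext1 M N := class_of (@ext_iso A M N) E.

Definition torsor_classes (A : pzRingType) (M N : lmodType A) : Type :=
  classes (@tors_iso A M N).

Definition torsor_class (A : pzRingType) (M N : lmodType A)
  (T : torsor M N) : torsor_classes M N := class_of (@tors_iso A M N) T.

(* Main.v *)
Require Import Defs.
From HB Require Import structures.
From mathcomp Require Import all_boot all_algebra.
From mathcomp Require Import boolp.

Set Implicit Arguments.
Unset Strict Implicit.
Unset Printing Implicit Defensive.

Import GRing.Theory.
Local Open Scope ring_scope.

(** An extension and its torsor have the same underlying object over [M], and
    [tau (n, p) = tau (n, 0) + p] by linearity; so [alpha] and [tau] determine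
    each other, and a morphism over [M] respects one exactly when it respects
    the other.  Hence isomorphism of extensions is isomorphism of the
    associated torsors, and every torsor comes from an extension. *)

(** [bijective] asks for an actual inverse function; choice ([cid]) supplies one by picking a
    preimage of each point. *)
Lemma inj_surj_bijective (S T : Type) (f : S -> T) :
  injective f -> (forall y, exists x, f x = y) -> bijective f.
Proof.
move=> f_inj f_surj; pose g y := sval (cid (f_surj y)).
have gK y : f (g y) = y by rewrite /g; case: cid.
by exists g => // x; apply: f_inj; rewrite gK.
Qed.

Section Classes.
Variables (T : Type) (r : T -> T -> Prop).

Lemma classes_ext (c d : classes r) : sval c = sval d -> c = d.
Proof. by case: c d => [c cP] [d dP] /= cd; apply: eq_exist. Qed.

Lemma class_of_surj (c : classes r) : exists x, class_of r x = c.
Proof. by case: c => [C [x Cx]]; exists x; apply: classes_ext. Qed.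

(** Classes are predicates: equal ones can be exchanged in [r x y], leaving [r y y]; conversely,
    related points have extensionally equal predicates by symmetry and transitivity. *)
Lemma class_ofP (x y : T) :
    (forall x, r x x) -> (forall x y, r x y -> r y x) ->
    (forall y x z, r x y -> r y z -> r x z) ->
  class_of r x = class_of r y <-> r x y.
Proof.
move=> r_refl r_sym r_trans; split=> [/(congr1 sval) /= -> // | rxy].
apply: classes_ext; apply/funext => z; apply/propext; split.
  exact/r_trans/r_sym.
exact: r_trans.
Qed.
End Classes.

(** Since [r] is the pullback of [s] along [F], it inherits the equivalence laws from [s]. The same
    pullback condition makes the induced map both well defined and injective. *)
Lemma classes_bijection (S T : Type) (r : S -> S -> Prop) (s : T -> T -> Prop)
    (F : S -> T) :
    (forall x, s x x) -> (forall x y, s x y -> s y x) ->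
    (forall y x z, s x y -> s y z -> s x z) ->
    (forall x y, r x y <-> s (F x) (F y)) ->
    (forall y, exists x, s (F x) y) ->
  exists Phi : classes r -> classes s,
    (forall x, Phi (class_of r x) = class_of s (F x)) /\ bijective Phi.
Proof.
move=> s_refl s_sym s_trans rsF F_surj.
have rP x y : class_of r x = class_of r y <-> s (F x) (F y).
  rewrite -rsF; apply: class_ofP => [z|u v|v u w]; rewrite !rsF //.
    exact: s_sym.
  exact: s_trans.
have sP x y : class_of s x = class_of s y <-> s x y by apply: class_ofP.
(* Apply [F] to a chosen representative; [rP] shows that the choice does not affect the class. *)
pose Phi c := class_of s (F (sval (cid (class_of_surj (r := r) c)))).
have PhiE x : Phi (class_of r x) = class_of s (F x).
  by rewrite /Phi; case: cid => z /= /rP szx; apply/sP.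
exists Phi; split=> //; apply: inj_surj_bijective => [c d|d].
  have [x <-] := class_of_surj c; have [y <-] := class_of_surj d.
  by rewrite !PhiE => /sP/rP.
have [y <-] := class_of_surj d; have [x sxy] := F_surj y.
by exists (class_of r x); rewrite PhiE; apply/sP.
Qed.

Section OverHom.
Variables (A : pzRingType) (M : lmodType A).

Fact over_id_subproof (f : Defs.over M) (p : f) :
  over_map f ((idfun : {linear f -> f}) p) = over_map f p.
Proof. by []. Qed.

Definition over_id (f : Defs.over M) : over_hom f f :=
  OverHom (@over_id_subproof f).

Fact over_comp_subproof (f g k : Defs.over M) (b : over_hom g k) (a : over_hom f g)
    (p : f) :
  over_map k ((b \o a : {linear f -> k}) p) = over_map f p.
Proof. by rewrite /= !hom_over. Qed.

Definition over_comp (f g k : Defs.over M) (b : over_hom g k) (a : over_hom f g) :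
  over_hom f k := OverHom (over_comp_subproof b a).
End OverHom.

Section Torsors.
Variables (A : pzRingType) (M N : lmodType A).
Implicit Types S T U : torsor M N.

Lemma tors_iso_refl T : tors_iso T T.
Proof. by exists (over_id T), (over_id T); split. Qed.

Lemma tors_iso_sym S T : tors_iso S T -> tors_iso T S.
Proof. by case=> h [k [hh hk hK kK]]; exists k, h; split. Qed.

Lemma tors_iso_trans T S U : tors_iso S T -> tors_iso T U -> tors_iso S U.
Proof.
case=> h [k [hh hk hK kK]] [h' [k' [hh' hk' hK' kK']]].
exists (over_comp h' h), (over_comp k k'); split=> [n p|n p||] /=.
- by rewrite hh hh'.
- by rewrite hk' hk.
- exact: can_comp.
- exact: can_comp.
Qed.

(** Split [(n, p)] as [(n, 0) + (0, p)] and use [tau T (0, p) = p]. *)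
Lemma tauD0 T n p : tau T (n, p) = tau T (n, 0) + p.
Proof.
rewrite -{2}(tors_tau0 (tors_struct T) p) -linearD; congr (tau T _).
by apply: injective_projections; rewrite /= ?addr0 ?add0r.
Qed.
End Torsors.

Section TorsorOfExtension.
Variables (A : pzRingType) (M N : lmodType A) (E : extension M N).

Definition ext_tau (x : N * E) : E := val (alpha E x.1) + x.2.

Fact ext_tau_linear : linear ext_tau.
Proof.
by move=> a x y; rewrite /ext_tau /= !linearP /= scalerDr addrACA.
Qed.

HB.instance Definition _ :=
  GRing.isLinear.Build A (N * E)%type E *:%R ext_tau ext_tau_linear.

Lemma over_map_ker (f : Defs.over M) (x : ker (over_map f)) : over_map f (val x) = 0.
Proof. exact/eqP/(valP x). Qed.

Fact ext_tau_over (x : beta N E) :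
  over_map E ((ext_tau : {linear beta N E -> E}) x) = over_map (beta N E) x.
Proof. by rewrite /= /ext_tau linearD over_map_ker add0r. Qed.

Definition ext_tau_hom : over_hom (beta N E) E := OverHom ext_tau_over.

Fact ext_tau0 (p : E) : ext_tau_hom (0, p) = p.
Proof. by rewrite /= /ext_tau !linear0 add0r. Qed.

Fact ext_tau_trans (x : (E * E)%type) : x \in fiber_product E E ->
  exists! n : N, ext_tau_hom (n, x.2) = x.1.
Proof.
rewrite unfold_in => /eqP Ex; rewrite /= /ext_tau /=.
(* The translation carrying [x.2] to [x.1] must be their difference, so [n] is its preimage under
   [alpha]. *)
have kerx : x.1 - x.2 \in in_ker (over_map E).
  by rewrite unfold_in linearB Ex subrr.
have [g gK Kg] := ext_alpha_bij (ext_struct E).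
exists (g (Ker kerx)); split=> [|n nx]; first by rewrite Kg subrK.
by rewrite -[n]gK; congr (g _); apply: val_inj; rewrite /= -nx addrK.
Qed.

Definition ext_torsor_on : torsor_on N E :=
  TorsorOn (ext_surj (ext_struct E)) ext_tau0 ext_tau_trans.

Definition ext_torsor : torsor M N := Torsor ext_torsor_on.
End TorsorOfExtension.

Section Correspondence.
Variables (A : pzRingType) (M N : lmodType A).

Lemma is_ext_homE (E F : extension M N) (h : over_hom E F) :
  is_ext_hom h <-> @is_tors_hom A M N (ext_torsor E) (ext_torsor F) h.
Proof.
split=> [hh n p | hh n]; first by rewrite /= /ext_tau /= linearD hh.
(* At [p = 0] the torsor action reduces to [alpha]. *)
by have := hh n 0; rewrite /= /ext_tau /= linear0 !addr0.
Qed.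

Lemma ext_isoE (E F : extension M N) :
  ext_iso E F <-> tors_iso (ext_torsor E) (ext_torsor F).
Proof.
by split=> -[h [k [/is_ext_homE hh /is_ext_homE hk hK kK]]]; exists h, k; split.
Qed.
End Correspondence.

Section ExtensionOfTorsor.
Variables (A : pzRingType) (M N : lmodType A) (T : torsor M N).

Fact tors_alpha_ker (n : N) : tau T (n, 0) \in in_ker (over_map T).
Proof. by rewrite unfold_in hom_over /= linear0. Qed.

Definition tors_alpha (n : N) : ker (over_map T) := Ker (tors_alpha_ker n).

Fact tors_alpha_linear : linear tors_alpha.
Proof.
move=> a m n; apply: val_inj; rewrite /= -linearP; congr (tau T _).
by apply: injective_projections; rewrite /= ?scaler0 ?addr0.
Qed.

HB.instance Definition _ :=
  GRing.isLinear.Build A N (ker (over_map T)) *:%R tors_alpha tors_alpha_linear.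

Fact tors_alpha_bij : bijective tors_alpha.
Proof.
(* A kernel element and [0] lie in the same fibre, so the torsor axiom applies to this pair; its
   uniqueness gives injectivity below and its existence gives surjectivity. *)
have tauP (x : ker (over_map T)) : exists! n, tau T (n, 0) = val x.
  apply: (tors_tau_trans (tors_struct T) (x := (val x, 0))).
  by rewrite unfold_in /= over_map_ker linear0.
apply: inj_surj_bijective => [m n /(congr1 val) mn | x].
  have [k [_ kP]] := tauP (tors_alpha n).
  by rewrite -(kP m mn) -(kP n erefl).
by have [n [nx _]] := tauP x; exists n; apply: val_inj.
Qed.

Definition tors_extension : extension M N :=
  Extension (ExtensionOn (tors_surj (tors_struct T))
    (tors_alpha_bij : bijective (tors_alpha : {linear N -> ker (over_map T)}))).

(** The identity is an isomorphism: the rebuilt action is [tau T (n, 0) + p], which is the original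
    one by [tauD0]. *)
Lemma tors_extensionK : tors_iso (ext_torsor tors_extension) T.
Proof.
exists (over_id T), (over_id T); split=> // n p.
  by rewrite /= tauD0.
by rewrite /= tauD0.
Qed.
End ExtensionOfTorsor.

Theorem mainTheorem1 (A : pzRingType) (M N : lmodType A) :
  exists Phi : Ext1 M N -> torsor_classes M N,
    (forall E : extension M N, exists t : torsor_on N E,
       (forall (n : N) (p : E), tors_tau t (n, p) = val (alpha E n) + p) /\
       Phi (ext_class E) = torsor_class (Torsor t)) /\
    bijective Phi.
Proof.
have surj (T : torsor M N) : exists E, tors_iso (ext_torsor E) T.
  by exists (tors_extension T); apply: tors_extensionK.
have [Phi [PhiE Phi_bij]] := classes_bijection (@tors_iso_refl A M N)
  (@tors_iso_sym A M N) (@tors_iso_trans A M N) (@ext_isoE A M N) surj.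
exists Phi; split=> // E; exists (ext_torsor_on E); split=> //.
exact: PhiE.
Qed.
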